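(* Let $U\subseteq C$, let $Z_n$, $n\in\mathbb{N}$, be convex stochastic processes in $U$ and let $Z$ be a convex stochastic process in $S^*$ having an almost surely unique minimizer, all defined on a probability space $(\Omega,\mathcal{A},\mathbb{P})$. Suppose $Z_n(t)\to Z(t)$ in probability for each $t\in D$, where $D$ is a countable dense subset of $\mathbb{R}$. Then: (1) If $U=S$, then $\sigma(Z_n)\to\sigma(Z)$ in probability, and $\sigma(Z)=\tau(Z)$ a.s. (2) If $U=S'$, then $\tau(Z_n)\to\tau(Z)$ in probability, and $\tau(Z)=\sigma(Z)$ a.s. (3) If $U=S^*$ and $\xi:S^*\to\mathbb{R}$ is any measurable selection of $A$, then $\xi(Z_n)\to\sigma(Z)$ in probability, and $\sigma(Z)=\tau(Z)$ a.s.
   Context: $C$ is the set of all convex functions $f:\mathbb{R}\to\mathbb{R}$; $A(f)=\{t\in\mathbb{R}: f(t)=\inf_{s\in\mathbb{R}} f(s)\}$. $S=\{f\in C: A(f)\neq\emptyset,\ \inf A(f)>-\infty\}$, $S'=\{f\in C: A(f)\ne\emptyset,\ \sup A(f)<\infty\}$, $S^*=S\cap S'$; $\sigma(f)=\min A(f)$ for $f\in S$ and $\tau(f)=\max A(f)$ for $f\in S'$. $Z$ having an almost surely unique minimizer means that $A(Z)$ is a singleton a.s. $\mathcal{C}$ is the $\sigma$-algebra on $C$ generated by the evaluations $f\mapsto f(t)$, $t\in\mathbb{R}$. A measurable selection of $A$ is a map $\xi:S^*\to\mathbb{R}$ that is Borel measurable with respect to the trace $\sigma$-algebra $S^*\cap\mathcal{C}$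 and satisfies $\xi(f)\in A(f)$ for all $f\in S^*$. A convex stochastic process is a map $Z:\Omega\to C$ such that $Z(t):\omega\mapsto Z(\omega)(t)$ is a real random variable for every $t\in\mathbb{R}$; it is a process in $U\subseteq C$ if $Z(\omega)\in U$ for all $\omega\in\Omega$. *)

(* Defs.v *)
From HB Require Import structures.
From mathcomp Require Import all_boot all_order all_algebra.
From mathcomp Require Import all_classical all_reals all_analysis.

Set Implicit Arguments.
Unset Strict Implicit.
Unset Printing Implicit Defensive.

Import Order.TTheory GRing.Theory Num.Theory.
Import numFieldNormedType.Exports.

Local Open Scope classical_set_scope.
Local Open Scope ring_scope.

Section ConvexFunctions.
Context {R : realType}.
Implicit Types (f : R -> R) (xi : (R -> R) -> R).

Definition convexC : set (R -> R) :=
  [set f | @convex_function R R^o setT f].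

(* The infimum is taken in \bar R, since f may be unbounded below. *)
Definition argminA f : set R :=
  [set t | (f t)%:E = ereal_inf (range (fun s => (f s)%:E))].

Definition classS : set (R -> R) :=
  [set f | [/\ convexC f, argminA f !=set0 &
               (-oo < ereal_inf (EFin @` argminA f))%E]].

Definition classS' : set (R -> R) :=
  [set f | [/\ convexC f, argminA f !=set0 &
               (ereal_sup (EFin @` argminA f) < +oo)%E]].

Definition Sstar : set (R -> R) := classS `&` classS'.

(* Minimum and maximum of argminA f; the default value 0 is only used
   when they do not exist. *)
Definition sigma f : R :=
  xget 0 [set t | argminA f t /\ lbound (argminA f) t].

Definition tau f : R :=
  xget 0 [set t | argminA f t /\ ubound (argminA f) t].

(* The sigma-algebra on the set convexC (not on all of R -> R) generated by
   the evaluation maps. *)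
Definition calC : set (set (R -> R)) :=
  <<s convexC, \bigcup_(t in [set: R])
      preimage_set_system convexC (fun f => f t) measurable >>.

(* Maps Sstar -> R are represented by total functions of which only the
   values on Sstar matter. *)
Definition measurable_selection xi : Prop :=
  preimage_set_system Sstar xi measurable `<=` strace calC Sstar /\
  forall f, Sstar f -> argminA f (xi f).

End ConvexFunctions.

Section Processes.
Context {d : measure_display} {Omega : measurableType d} {R : realType}.
Implicit Types (Z : Omega -> R -> R) (U : set (R -> R)).

Definition convex_process Z : Prop :=
  (forall w, convexC (Z w)) /\
  (forall t, measurable_fun [set: Omega] (fun w => Z w t)).

Definition convex_process_in U Z : Prop :=
  convex_process Z /\ forall w, U (Z w).

Definition as_unique_minimizer (P : probability Omega R) Z : Prop :=
  {ae P, forall w, exists t, argminA (Z w) = [set t]}.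

(* Measurability is part of the definition: the library's measures are total
   on sets, with unspecified values on non-measurable ones. *)
Definition cvg_in_probability (P : probability Omega R)
    (X : nat -> Omega -> R) (Y : Omega -> R) : Prop :=
  [/\ forall n, measurable_fun [set: Omega] (X n),
      measurable_fun [set: Omega] Y &
      forall eps : R, 0 < eps ->
        P [set w | eps < `|X n w - Y w|] @[n --> \oo] --> 0%E].

End Processes.

(* Main.v *)
Require Import Defs.
From HB Require Import structures.
From mathcomp Require Import all_boot all_order all_algebra.
From mathcomp Require Import all_classical all_reals all_analysis.
From mathcomp Require Import measurable_realfun.
From mathcomp Require Import ring lra.

Import Order.TTheory GRing.Theory Num.Theory.
Import numFieldNormedType.Exports.

Local Open Scope classical_set_scope.
Local Open Scope ring_scope.

(** The theorem is deterministic at heart. If f is convex with unique minimizer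
    x, then every neighbourhood of x contains points a < c < b of the dense set
    D with f c < f a and f c < f b (strict_bracket). These strict inequalities
    persist for any convex g that is close to f at the three points a, c, b,
    and they confine all minimizers of g to ]a, b[ (lt_argminA, gt_argminA).
    So closeness at three points, without any uniformity, keeps every minimizer
    of g near x.

    For random functions the three points, and the gap in the inequalities,
    depend on the outcome w. There are only countably many choices, so the
    events on which a given choice works cover almost all of the probability
    space. On each of them the probability of a large error tends to 0, by
    convergence in probability at three fixed points; a countable cover by such
    events suffices (cvg0_probability_cover). This yields convergence for every
    measurable choice of minimizers (cvg_in_probability_argminA).

    It remains to see that sigma (Zn n), tau (Zn n) and xi (Zn n) are such
    choices. Smallest minimizers exist (sigmaP), and sigma f > x holds exactly
    when f q < f x for some rational q > x (lt_sigmaP), which gives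
    measurability; tau is sigma of the reflected function, up to sign. For xi
    one needs that a process is measurable for the sigma-algebra calC
    (measurable_calC_preimage). *)

(** * Minimizers of convex functions *)

Section ConvexMinimizers.
Set Implicit Arguments.
Unset Strict Implicit.
Context {R : realType}.
Implicit Types (f : R -> R) (a b c p q s t x y : R).

Lemma argminAP f t : argminA f t <-> forall s, f t <= f s.
Proof.
split=> [ft s|ft].
  by rewrite -lee_fin [X in (X <= _)%E]ft; apply: ereal_inf_lbound; exists s.
apply/eqP; rewrite eq_le; apply/andP; split.
  by apply: le_ereal_inf_tmp => _ [s _ <-]; rewrite lee_fin.
by apply: ereal_inf_lbound; exists t.
Qed.

(** The three-point form of convexity with denominators cleared, so that the
    degenerate case p = q is covered and arithmetic tactics apply. *)
Lemma convexC_chord f p c q : convexC f -> p <= c -> c <= q ->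
  (q - p) * f c <= (q - c) * f p + (c - p) * f q.
Proof.
move=> cf pc cq; have [pq|qp] := ltP p q; last first.
  have cp : c = p by lra.
  have qp' : q = p by lra.
  by rewrite cp qp' !subrr !mul0r addr0.
have qp0 : 0 < q - p by lra.
have l0 : 0 <= (q - c) / (q - p) by rewrite divr_ge0//; lra.
have l1 : (q - c) / (q - p) <= 1 by rewrite ler_pdivrMr//; lra.
set l := (q - c) / (q - p) in l0 l1.
have : f (l * p + (1 - l) * q) <= l * f p + (1 - l) * f q.
  by apply: (cf (Itv01 l0 l1) p q); exact: mem_setT.
have -> : l * p + (1 - l) * q = c by rewrite /l; field; lra.
move=> /(ler_wpM2l (ltW qp0)) /le_trans; apply.
rewrite le_eqVlt; apply/orP; left; apply/eqP; rewrite /l; field; lra.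
Qed.

(** Reflection t |-> - t exchanges smallest and largest minimizers; through
    the next lemmas every statement about tau reduces to one about sigma. *)
Lemma convexC_oppr f : convexC f -> convexC (fun t => f (- t)).
Proof.
move=> cf l p q _ _; rewrite convN; apply: cf; exact: mem_setT.
Qed.

Lemma argminA_oppr f t : argminA (fun s => f (- s)) t <-> argminA f (- t).
Proof.
by rewrite !argminAP; split=> h s //; rewrite -[s]opprK.
Qed.

(** A strict descent from p to q > p locates every minimizer: were x <= p, then
    p would lie between x and q, where f is at most max (f x) (f q) = f q. *)
Lemma lt_argminA f p q x : convexC f -> argminA f x -> p < q -> f q < f p ->
  p < x.
Proof.
move=> cf /argminAP fx pq fqp; rewrite ltNge; apply/negP => xp.
have := convexC_chord cf xp (ltW pq); have := fx q; nra.
Qed.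

Lemma gt_argminA f p q x : convexC f -> argminA f x -> q < p -> f q < f p ->
  x < p.
Proof.
move=> cf fx qp fqp; rewrite -ltrN2.
apply: (@lt_argminA (fun t => f (- t)) _ (- q)); rewrite ?opprK ?ltrN2//.
  exact: convexC_oppr.
by apply/argminA_oppr; rewrite opprK.
Qed.

(** The value at c is an average of f p and f x in which f x has positive
    weight. This replaces any appeal to the continuity of f near x. *)
Lemma convexC_descent f p c x : convexC f -> f x < f p -> p < c -> c <= x ->
  f c < f p.
Proof.
move=> cf fxp pc cx; have := convexC_chord cf (ltW pc) cx; nra.
Qed.

Lemma dense_lt (D : set R) a b : dense D -> a < b ->
  exists c, [/\ D c, a < c & c < b].
Proof.
move=> dD ab.
have [||c []] := dD `]a, b[%classic.
- by exists ((a + b) / 2); rewrite /= in_itv/=; apply/andP; split; lra.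
- exact: interval_open.
by rewrite /= in_itv/= => /andP[]; exists c.
Qed.

(** The bracket is the form of uniqueness that is stable under perturbation:
    finitely many strict inequalities between values of f on D. The middle
    point is found by descending towards x from the lower of the two ends. *)
Lemma strict_bracket (D : set R) f x eps : dense D -> convexC f ->
  argminA f = [set x] -> 0 < eps ->
  exists a c b, [/\ [/\ D a, D c & D b],
    [/\ x - eps < a, a < c, c < b & b < x + eps], f c < f a & f c < f b].
Proof.
move=> dD cf fx e0.
have [a [Da xa ax]] : exists a, [/\ D a, x - eps < a & a < x].
  by apply: dense_lt => //; lra.
have [b [Db xb bx]] : exists b, [/\ D b, x < b & b < x + eps].
  by apply: dense_lt => //; lra.
have fxx : argminA f x by rewrite fx.
have slt t : t != x -> f x < f t.
  move=> tx; rewrite ltNge; apply/negP => ftx; move/eqP: tx; apply.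
  suff : argminA f t by rewrite fx.
  by apply/argminAP => s; apply: (le_trans ftx); move/argminAP: fxx; apply.
have fa : f x < f a by apply: slt; rewrite lt_eqF.
have fb : f x < f b by apply: slt; rewrite gt_eqF.
clear slt fx.
have [fab|/ltW fba] := leP (f a) (f b).
- have [c [Dc ac cx]] := dense_lt dD ax.
  have fc := convexC_descent cf fa ac (ltW cx).
  by exists a, c, b; split; [split|split; lra|lra|lra].
- have [c [Dc xc cb]] := dense_lt dD xb.
  have fc : f c < f b.
    rewrite -[c]opprK -[b]opprK.
    apply: (@convexC_descent (fun t => f (- t)) _ _ (- x));
      rewrite ?opprK; try lra.
    exact: convexC_oppr.
  by exists a, c, b; split; [split|split; lra|lra|lra].
Qed.

(** The smallest minimizer is m = inf A(f). It is attained because convexity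
    bounds f m by the chord from m - 1 to a minimizer x close to m, and
    this chord tends to the minimal value at m as x decreases to m. *)
Lemma sigmaP f : classS f ->
  argminA f (sigma f) /\ lbound (argminA f) (sigma f).
Proof.
move=> [cf [t ft] infA].
suff [m] : exists m, argminA f m /\ lbound (argminA f) m.
  exact: (@xgetI _ 0 [set t | argminA f t /\ lbound (argminA f) t]).
have hinf : has_inf (argminA f).
  split; first by exists t.
  have : ereal_inf (EFin @` argminA f) \is a fin_num.
    rewrite fin_numElt infA /= (le_lt_trans _ (ltry t))//.
    by apply: ereal_inf_lbound; exists t.
  move=> /fineK inffin; exists (fine (ereal_inf (EFin @` argminA f))) => x fx.
  by rewrite -lee_fin inffin; apply: ereal_inf_lbound; exists x.
set m := inf (argminA f); exists m; split; last first.
  by move=> x fx; exact: ge_inf hinf.2 _ fx.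
apply/argminAP => s; apply: (@le_trans _ _ (f t)); last first.
  by move/argminAP: ft; apply.
apply/ler_addgt0Pr => e e0.
(* K dominates the slope of the chord, and the summand 1 makes it positive. *)
pose K := f (m - 1) - f t + 1.
have K0 : 0 < K by move/argminAP: ft => /(_ (m - 1)); rewrite /K; lra.
have eK : 0 < e / K by rewrite divr_gt0.
have [x fx xm] := inf_adherent eK hinf.
have mx : m <= x by exact: ge_inf hinf.2 _ fx.
have m1 : m - 1 <= m by lra.
have := convexC_chord cf m1 mx.
have -> : f x = f t.
  by apply/eqP; rewrite eq_le; move/argminAP: fx => ->; move/argminAP: ft => ->.
have : (x - m) * K <= e by rewrite -ler_pdivlMr//; move: xm; rewrite -/m; lra.
rewrite /K; move: (f (m - 1)) (f t) (f m) => u v w; nra.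
Qed.

(** If x < sigma f, then x is not a minimizer and f lies below f x on all of
    ]x, sigma f], hence at a rational point; the converse is lt_argminA. So a
    countable union of conditions on two values of f each describes
    x < sigma f, which makes sigma measurable. *)
Lemma lt_sigmaP f x : classS f ->
  x < sigma f <-> exists2 q : rat, x < ratr q & f (ratr q) < f x.
Proof.
move=> Sf; have [fs sl] := sigmaP Sf; have [cf _ _] := Sf; split=> [xs|[q xq fq]].
  have fsx : f (sigma f) < f x.
    rewrite ltNge; apply/negP => fxs.
    suff /sl : argminA f x by lra.
    by apply/argminAP => s; apply: (le_trans fxs); move/argminAP: fs; apply.
  have [_ [[q _ <-] xq qs]] := dense_lt (@dense_rat R) xs.
  by exists q => //; apply: (convexC_descent cf fsx xq); exact: ltW.
exact: lt_argminA fs xq fq.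
Qed.

Lemma classS'_oppr f : classS' f -> classS (fun t => f (- t)).
Proof.
move=> [cf [t ft] supA]; split; first exact: convexC_oppr.
  by exists (- t); apply/argminA_oppr; rewrite opprK.
rewrite ereal_infEN.
have -> : -%E @` (EFin @` argminA (fun t => f (- t))) = EFin @` argminA f.
  apply/seteqP; split=> [_ [_ [s /argminA_oppr fs <-] <-]|_ [s fs <-]].
    by exists (- s).
  exists (- s)%:E; last by rewrite /= opprK.
  by exists (- s) => //; apply/argminA_oppr; rewrite opprK.
by rewrite lteNr.
Qed.

Lemma tau_oppr f : classS' f -> tau f = - sigma (fun t => f (- t)).
Proof.
move=> /classS'_oppr/sigmaP[/argminA_oppr fs sl].
apply: xget_unique => [|y [fy uy]]; last first.
  apply/eqP; rewrite eq_le uy// andbT lerNr; apply: sl.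
  by apply/argminA_oppr; rewrite opprK.
split=> // y fy; rewrite lerNr; apply: sl.
by apply/argminA_oppr; rewrite opprK.
Qed.

Lemma tau_argminA f : classS' f -> argminA f (tau f).
Proof.
move=> Sf; rewrite tau_oppr//; apply/argminA_oppr.
by have [] := sigmaP (classS'_oppr Sf).
Qed.

Lemma sigma_eq_tau f x : argminA f = [set x] -> sigma f = tau f.
Proof.
move=> fx; transitivity x; [|symmetry]; apply: xget_unique; rewrite fx.
- by split=> // y ->.
- by move=> y [].
- by split=> // y ->.
- by move=> y [].
Qed.

End ConvexMinimizers.

(** * Measurability of the selected minimizers *)

Section RandomMinimizers.
Set Implicit Arguments.
Unset Strict Implicit.
Context {d : measure_display} {Omega : measurableType d} {R : realType}.
Implicit Types (Z : Omega -> R -> R) (P : probability Omega R).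

Lemma measurable_lt_set (f g : Omega -> R) : measurable_fun setT f ->
  measurable_fun setT g -> measurable [set w | f w < g w].
Proof.
move=> mf mg; rewrite -[X in measurable X]setTI.
have := measurable_fun_ltr mf mg measurableT.
by move=> /(_ [set true]); apply.
Qed.

Lemma measurable_sigma Z : convex_process_in classS Z ->
  measurable_fun [set: Omega] (fun w => sigma (Z w)).
Proof.
move=> [[_ mZ] SZ]; apply: (measurability _ (RGenOInfty.measurableE R)).
move=> _ [_ [x ->] <-]; rewrite setTI.
rewrite (_ : _ @^-1` _ =
    \bigcup_(q : rat) [set w | x < ratr q /\ Z w (ratr q) < Z w x]).
  apply: bigcupT_measurable_rat => q; have [xq|xq] := boolP (x < ratr q).
    rewrite (_ : [set _ | _] = [set w | Z w (ratr q) < Z w x]).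
      exact: measurable_lt_set.
    by apply/seteqP; split=> w /= // [].
  by rewrite (_ : [set _ | _] = set0)// -subset0 => w [].
apply/seteqP; split=> [w|w [q _ [xq Zq]]] /=; rewrite in_itv/= andbT.
  by move/(lt_sigmaP _ (SZ w)) => [q xq Zq]; exists q.
by apply/(lt_sigmaP _ (SZ w)); exists q.
Qed.

Lemma measurable_tau Z : convex_process_in classS' Z ->
  measurable_fun [set: Omega] (fun w => tau (Z w)).
Proof.
move=> [[cZ mZ] SZ]; under eq_fun do rewrite tau_oppr//.
apply: measurableT_comp => //.
apply: (@measurable_sigma (fun w t => Z w (- t))); split; first split.
- by move=> w; exact: convexC_oppr.
- by [].
- by move=> w; exact: classS'_oppr.
Qed.

(** Joint measurability of a process as a map into the function space, from
    its evaluations: the sets with measurable preimage form a sigma-algebra on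
    convexC that contains the generators of calC. *)
Lemma measurable_calC_preimage Z C : convex_process Z -> calC C ->
  measurable (Z @^-1` C).
Proof.
move=> [cZ mZ]; suff : calC `<=` [set C | measurable (Z @^-1` C)] by exact.
apply: smallest_sub => [|_ [t _ [B mB <-]]] /=.
  split=> [|A mA|A mA] /=; first by rewrite preimage_set0.
    rewrite (_ : _ @^-1` _ = ~` (Z @^-1` A)); first exact: measurableC.
    by apply/seteqP; split=> w /= => [[]|].
  by rewrite preimage_bigcup; exact: bigcupT_measurable.
rewrite (_ : _ @^-1` _ = (fun w => Z w t) @^-1` B).
  by rewrite -[X in measurable X]setTI; exact: mZ.
by apply/seteqP; split=> w /= => [[]|].
Qed.

Lemma measurable_selection_comp xi Z : measurable_selection xi ->
  convex_process_in Sstar Z -> measurable_fun [set: Omega] (fun w => xi (Z w)).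
Proof.
move=> [mxi _] [pZ SZ] _ B mB; rewrite setTI.
have [C mC CB] : strace calC Sstar (Sstar `&` xi @^-1` B).
  by apply: mxi; exists B.
rewrite (_ : _ @^-1` B = Z @^-1` C); first exact: measurable_calC_preimage.
apply/seteqP; split=> w /= Bw.
  by have [] : (C `&` Sstar) (Z w) by rewrite CB; split.
by have [] : (Sstar `&` xi @^-1` B) (Z w) by rewrite -CB; split.
Qed.

(** * Events of vanishing probability *)

Lemma nneg_cvge0P (u : nat -> \bar R) : (forall n, (0 <= u n)%E) ->
  u n @[n --> \oo] --> 0%E <->
  forall e : R, 0 < e -> \forall n \near \oo, (u n < e%:E)%E.
Proof.
move=> u0; split=> [/fine_cvgP[ufin /cvgrPdist_lt ucvg] e e0|ucvg].
  near=> n.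
  have un : u n \is a fin_num by near: n.
  rewrite -(fineK un) lte_fin -[fine _]ger0_norm ?fine_ge0// -normrN -sub0r.
  by near: n; apply: ucvg.
apply/fine_cvgP; split.
  near=> n; rewrite ge0_fin_numE//.
  apply: (@lt_trans _ _ 1%:E); last exact: ltry.
  by near: n; apply: ucvg.
apply/cvgrPdist_lt => e e0; near=> n.
rewrite sub0r normrN /= ger0_norm ?fine_ge0//.
have une : (u n < e%:E)%E by near: n; apply: ucvg.
rewrite -lte_fin fineK// ge0_fin_numE//; exact: lt_trans une (ltry _).
Unshelve. all: by end_near. Qed.

Lemma le_probability P (A B : set Omega) : measurable A -> measurable B ->
  A `<=` B -> (P A <= P B)%E.
Proof. by move=> mA mB AB; apply: le_measure; rewrite ?inE. Qed.

Lemma cvg0_probabilityU P (A B C : nat -> set Omega) :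
  (forall n, measurable (A n)) -> (forall n, measurable (B n)) ->
  (forall n, measurable (C n)) -> (forall n, C n `<=` A n `|` B n) ->
  P (A n) @[n --> \oo] --> 0%E -> P (B n) @[n --> \oo] --> 0%E ->
  P (C n) @[n --> \oo] --> 0%E.
Proof.
move=> mA mB mC CAB PA PB.
apply: (@squeeze_cvge _ _ _ _ (fun=> 0%E) _ (fun n => P (A n) + P (B n))%E).
- near=> n; rewrite measure_ge0/=; apply: le_trans (measureU2 P (mA n) (mB n)).
  by apply: le_probability => //; exact: measurableU.
- exact: cvg_cst.
- by rewrite -[X in _ --> X]adde0; exact: cvgeD.
Unshelve. all: by end_near. Qed.

(** The events G on which B n has vanishing probability form a sigma-ideal
    containing the null sets: finite unions V K of the G i belong to it by
    subadditivity, and by continuity from above the complement of V K has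
    arbitrarily small probability, whatever n is. *)
Lemma cvg0_probability_cover P (I : countType) (G : I -> set Omega)
    (B : nat -> set Omega) :
  (forall i, measurable (G i)) -> (forall n, measurable (B n)) ->
  {ae P, forall w, exists i, G i w} ->
  (forall i, P (G i `&` B n) @[n --> \oo] --> 0%E) ->
  P (B n) @[n --> \oo] --> 0%E.
Proof.
move=> mG mB Gae PGB.
(* The events are listed along the encoding of I in nat; codes of no index get
   the empty set. *)
pose F k := oapp G set0 (unpickle k).
have mF k : measurable (F k) by rewrite /F; case: unpickle => /=.
pose V K := \big[setU/set0]_(k < K) F k.
have mV K : measurable (V K) by exact: bigsetU_measurable.
have PVB K : P (V K `&` B n) @[n --> \oo] --> 0%E.
  elim: K => [|K IH].
    rewrite /V big_ord0; under eq_fun do rewrite set0I measure0.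
    exact: cvg_cst.
  apply: (@cvg0_probabilityU P (fun n => V K `&` B n) (fun n => F K `&` B n)) => //.
  - by move=> n; exact: measurableI.
  - by move=> n; exact: measurableI.
  - by move=> n; exact: measurableI.
  - by move=> n; rewrite /V big_ord_recr/= setIUl.
  - rewrite /F; case: unpickle => [i|] /=; first exact: PGB.
    under eq_fun do rewrite set0I measure0.
    exact: cvg_cst.
have PC : P (~` V K) @[K --> \oo] --> 0%E.
  have mC K : measurable (~` V K) by exact: measurableC.
  have mI : measurable (\bigcap_K ~` V K) by exact: bigcapT_measurable.
  have -> : 0%E = P (\bigcap_K ~` V K).
    apply/esym/(negligibleP _ mI); apply: negligibleS Gae => w Vw [i Giw].
    apply: (Vw (pickle i).+1) => //.
    by rewrite /V big_ord_recr/=; right; rewrite /F pickleK.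
  apply: nonincreasing_cvg_mu => //.
    exact: le_lt_trans (probability_le1 _ _) (ltry 1).
  apply/nonincreasing_seqP => K; apply/subsetPset; apply: subsetC.
  by rewrite /V big_ord_recr/=; exact: subsetUl.
apply/nneg_cvge0P => // e e0.
have e2 : 0 < e / 2 by lra.
have [K PCK] : exists K, (P (~` V K) < (e / 2)%:E)%E.
  move/nneg_cvge0P : PC => /(_ _)/(_ _ e2) [//|K _ KC].
  by exists K; apply: KC => /=.
move/nneg_cvge0P : (PVB K) => /(_ _)/(_ _ e2) [//|N _ PN].
near=> n.
have {}PN : (P (V K `&` B n) < (e / 2)%:E)%E by apply: PN; near: n; exists N.
rewrite [e]splitr EFinD; apply: le_lt_trans (lteD PN PCK).
have mVB : measurable (V K `&` B n) by exact: measurableI.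
apply: le_trans (measureU2 P mVB (measurableC (mV K))).
apply: le_probability => //; first by apply: measurableU => //; exact: measurableC.
by move=> w Bw; have [?|?] := pselect (V K w); [left|right].
Unshelve. all: by end_near. Qed.

Lemma measurable_deviation (X Y : Omega -> R) (e : R) :
  measurable_fun [set: Omega] X -> measurable_fun [set: Omega] Y ->
  measurable [set w | e < `|X w - Y w|].
Proof.
move=> mX mY; apply: measurable_lt_set => //.
by apply: measurableT_comp => //; exact: measurable_funB.
Qed.

Lemma lt_perturb (y z y' z' e : R) : y + e < z ->
  `|y' - y| <= e / 2 -> `|z' - z| <= e / 2 -> y' < z'.
Proof. by move=> yz; rewrite !ler_norml => /andP[? ?] /andP[? ?]; lra. Qed.

(** * Convergence of minimizers *)

(** The selection of minimizers X of the processes Zn is arbitrary, which is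
    why this single statement serves sigma, tau and any measurable selection.
    By strict_bracket, almost every w lies in one of countably many events,
    indexed by three points of D and a lower bound of the gap between the
    values of Z there, on which the limit is bracketed within eps. On such an
    event, a large error of X n forces Zn n to be far from Z at one of the three
    points, which has vanishing probability. *)
Lemma cvg_in_probability_argminA P (Zn : nat -> Omega -> R -> R) Z (D : set R)
    (X : nat -> Omega -> R) (Y : Omega -> R) :
  (forall n w, convexC (Zn n w)) -> convex_process Z ->
  countable D -> dense D ->
  (forall t, D t ->
    cvg_in_probability P (fun n w => Zn n w t) (fun w => Z w t)) ->
  (forall n, measurable_fun [set: Omega] (X n)) ->
  measurable_fun [set: Omega] Y ->
  (forall n w, argminA (Zn n w) (X n w)) ->
  {ae P, forall w, argminA (Z w) = [set Y w]} ->
  cvg_in_probability P X Y.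
Proof.
move=> cZn [cZ mZ] cD dD ZnZ mX mY AX AY; split=> // eps eps0.
have [D0|[u]] := pfcard_geP cD.
  by have [c [+ _ _]] := dense_lt dD (@ltr01 R); rewrite D0.
have uD i : D (u i) by exact: funS.
pose dev i m n := [set w | m.+1%:R^-1 / 2 < `|Zn n w (u i) - Z w (u i)|].
have mdev i m n : measurable (dev i m n).
  by have [mZn _ _] := ZnZ _ (uD i); exact: measurable_deviation.
have Pdev i m : P (dev i m n) @[n --> \oo] --> 0%E.
  by have [_ _] := ZnZ _ (uD i); apply; rewrite divr_gt0.
pose G (v : nat * nat * nat * nat) := let: (i, j, k, m) := v in
  [set w | u i < u j < u k /\
    [/\ Y w - eps < u i, u k < Y w + eps,
        Z w (u j) + m.+1%:R^-1 < Z w (u i) &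
        Z w (u j) + m.+1%:R^-1 < Z w (u k)]].
have mG v : measurable (G v).
  case: v => [[[i j] k] m]; rewrite /G.
  have [ijk|ijk] := boolP (u i < u j < u k); last first.
    by rewrite (_ : [set _ | _] = set0)// -subset0 => w [].
  rewrite (_ : [set _ | _] =
      [set w | Y w - eps < u i] `&` [set w | u k < Y w + eps] `&`
      [set w | Z w (u j) + m.+1%:R^-1 < Z w (u i)] `&`
      [set w | Z w (u j) + m.+1%:R^-1 < Z w (u k)]).
    have mZD : measurable_fun setT (fun w => Z w (u j) + m.+1%:R^-1).
      exact: measurable_funD.
    apply: measurableI; [apply: measurableI; [apply: measurableI|]|];
      apply: measurable_lt_set => //.
      exact: measurable_funB.
    exact: measurable_funD.
  by apply/seteqP; split=> w /= => [[_ []]|[[[]]]]; do ?split.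
have mB n : measurable [set w | eps < `|X n w - Y w|].
  by exact: measurable_deviation.
apply: (cvg0_probability_cover mG mB).
  apply: filterS AY => w AY.
  have [a [c [b [[Da Dc Db] [ea ac cb be] fca fcb]]]] :=
    strict_bracket dD (cZ w) AY eps0.
  have [i _ ui] : range u a by apply: surj.
  have [j _ uj] : range u c by apply: surj.
  have [k _ uk] : range u b by apply: surj.
  have /ltr_add_invr[m fm] : Z w c < Num.min (Z w a) (Z w b).
    by rewrite lt_min fca.
  move: fm; rewrite lt_min => /andP[fma fmb].
  by exists (i, j, k, m); rewrite /G /= ui uj uk ac cb.
move=> [[[i j] k] m].
have mij n : measurable (dev i m n `|` dev j m n) by exact: measurableU.
apply: (cvg0_probabilityU mij (mdev k m) _ _ _ (Pdev k m)).
- by move=> n; exact: measurableI.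
- move=> n w [[/andP[ij jk] [Yi kY Zji Zjk]] Xeps].
  (* If no deviation exceeds half the gap, the bracket survives in Zn n w and
     its minimizer X n w is caught in the window of radius eps. *)
  apply: contrapT => /not_orP[/not_orP[]].
  move=> /negP; rewrite -leNgt => di /negP; rewrite -leNgt => dj.
  move=> /negP; rewrite -leNgt => dk.
  have iX := lt_argminA (cZn n w) (AX n w) ij (lt_perturb Zji dj di).
  have Xk := gt_argminA (cZn n w) (AX n w) jk (lt_perturb Zjk dj dk).
  move: Xeps; apply/negP; rewrite /= -leNgt ler_norml.
  by apply/andP; split; lra.
- exact: (cvg0_probabilityU (mdev i m) (mdev j m) mij (fun=> @subset_refl _ _)).
Qed.

End RandomMinimizers.

Theorem theorem10 (R : realType) (d : measure_display)
    (Omega : measurableType d) (P : probability Omega R)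
    (U : set (R -> R)) (Zn : nat -> Omega -> R -> R) (Z : Omega -> R -> R)
    (D : set R)
    (hU : U `<=` convexC)
    (hZn : forall n, convex_process_in U (Zn n))
    (hZ : convex_process_in Sstar Z)
    (huniq : as_unique_minimizer P Z)
    (hDcount : countable D) (hDdense : dense D)
    (hcvg : forall t, D t ->
      cvg_in_probability P (fun n w => Zn n w t) (fun w => Z w t)) :
  [/\ U = classS ->
        cvg_in_probability P (fun n w => sigma (Zn n w)) (fun w => sigma (Z w))
        /\ {ae P, forall w, sigma (Z w) = tau (Z w)},
      U = classS' ->
        cvg_in_probability P (fun n w => tau (Zn n w)) (fun w => tau (Z w))
        /\ {ae P, forall w, tau (Z w) = sigma (Z w)} &
      U = Sstar -> forall xi : (R -> R) -> R, measurable_selection xi ->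
        cvg_in_probability P (fun n w => xi (Zn n w)) (fun w => sigma (Z w))
        /\ {ae P, forall w, sigma (Z w) = tau (Z w)} ].
Proof.
have [pZ SZ] := hZ.
have st : {ae P, forall w, sigma (Z w) = tau (Z w)}.
  by apply: filterS huniq => w [t]; exact: sigma_eq_tau.
have uniq (Y : Omega -> R) : (forall w, argminA (Z w) (Y w)) ->
    {ae P, forall w, argminA (Z w) = [set Y w]}.
  by move=> AY; apply: filterS huniq => w [t At]; have := AY w; rewrite At => ->.
have cZn n w : convexC (Zn n w) by have [[]] := hZn n.
have Asigma w : argminA (Z w) (sigma (Z w)) by have [/sigmaP[]] := SZ w.
have Atau w : argminA (Z w) (tau (Z w)).
  by apply: tau_argminA; have [] := SZ w.
have msigma : measurable_fun setT (fun w => sigma (Z w)).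
  by apply: measurable_sigma; split=> // w; have [] := SZ w.
have cvgX (X : nat -> Omega -> R) (Y : Omega -> R) :=
  @cvg_in_probability_argminA _ _ _ P Zn Z D X Y cZn pZ hDcount hDdense hcvg.
split=> [US|US|US xi mxi]; subst U.
- split=> //; apply: cvgX => //; last exact: uniq.
    by move=> n; exact: measurable_sigma.
  by move=> n w; have [_ /(_ w)/sigmaP[]] := hZn n.
- split; last by apply: filterS st => w ->.
  apply: cvgX => //; last exact: uniq.
  + by move=> n; exact: measurable_tau.
  + by apply: measurable_tau; split=> // w; have [] := SZ w.
  + by move=> n w; apply: tau_argminA; have [_] := hZn n.
- split=> //; apply: cvgX => //; last exact: uniq.
    by move=> n; exact: measurable_selection_comp.
  by move=> n w; have [_ S] := hZn n; apply: mxi.2.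
Qed.
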